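(* Let $\lambda$ be a cardinal with $\omega_1<\lambda<2^{\omega_1}$. Suppose that there exists a tree $T$ of height $\omega_1$ such that (i) $T$ has exactly $\lambda$ uncountable branches, and (ii) each level of $T$ has at most $\omega_1$ nodes. Then there is a structure $\mathcal M$ of cardinality $\omega_1$ with exactly $\lambda$ automorphisms.
   Context: A tree is a partially ordered set in which the set of predecessors of every node is well-ordered; the height of a node is the order type of its set of predecessors, and the levels are the sets of nodes of a given height. A branch is a maximal linearly ordered subset; in a tree of height $\omega_1$ the uncountable branches are those of order type $\omega_1$. The vocabulary of the structure may be uncountable. *)

(* Defs.v *)
From HB Require Import structures.
From mathcomp Require Import all_boot all_order.
From mathcomp Require Import boolp classical_sets functions cardinality wochoice.

Set Implicit Arguments.
Unset Strict Implicit.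
Unset Printing Implicit Defensive.

Local Open Scope classical_set_scope.
Local Open Scope card_scope.
Local Open Scope order_scope.

Definition card_lt (T U : Type) (A : set T) (B : set U) : Prop :=
  A #<= B /\ A #!= B.

Definition order_iso (d d' : Order.disp_t) (T : porderType d)
    (U : porderType d') (A : set T) (B : set U) : Prop :=
  exists f : T -> U,
    set_bij A B f /\ {in A &, {mono f : x y / x <= y}}.

Definition below (d : Order.disp_t) (T : porderType d) (x : T) : set T :=
  [set y | y < x].

(* There is no type of ordinals: an ordered type [W] stands for the ordinal
   omega_1 when it is an uncountable well-order with countable proper initial
   segments. The element [w] of [W] then stands for the countable ordinal that
   is the order type of [below w], and [set: W] for the cardinal omega_1. *)
Definition is_omega1 (d : Order.disp_t) (W : orderType d) : Prop :=
  [/\ well_order (<=%O : rel W),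
      ~ countable [set: W] &
      forall w : W, countable (below w)].

Definition is_tree (d : Order.disp_t) (T : porderType d) : Prop :=
  forall x : T, wo_chain (<=%O : rel T) [pred y | y < x].

Definition level (d dW : Order.disp_t) (T : porderType d) (W : orderType dW)
    (w : W) : set T :=
  [set x | order_iso (below x) (below w)].
Arguments level {d dW} T {W} w.

(* For [W] representing omega_1: the heights of the nodes of [T] are exactly
   the countable ordinals, i.e. omega_1 is the least ordinal whose level is
   empty. *)
Definition has_height (d dW : Order.disp_t) (T : porderType d)
    (W : orderType dW) : Prop :=
  (forall w : W, level T w !=set0) /\
  (forall x : T, exists w : W, level T w x).

Definition is_chain (d : Order.disp_t) (T : porderType d) (B : set T) : Prop :=
  total_on B (fun x y : T => x <= y).

Definition is_branch (d : Order.disp_t) (T : porderType d) (B : set T) : Prop :=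
  is_chain B /\ forall C : set T, is_chain C -> B `<=` C -> C = B.

Definition uncountable_branches (d : Order.disp_t) (T : porderType d) :
    set (set T) :=
  [set B | is_branch B /\ ~ countable B].
Arguments uncountable_branches {d} T.

(* Constants are the function symbols of arity 0. *)
Record vocabulary := Vocabulary {
  fun_symb : Type;
  fun_arity : fun_symb -> nat;
  rel_symb : Type;
  rel_arity : rel_symb -> nat
}.

Record structure (V : vocabulary) := Structure {
  carrier :> Type;
  fun_interp : forall f : fun_symb V, (fun_arity f).-tuple carrier -> carrier;
  rel_interp : forall r : rel_symb V, set ((rel_arity r).-tuple carrier)
}.
Arguments fun_interp {V} M f t : rename.
Arguments rel_interp {V} M r _ : rename.

Definition is_automorphism (V : vocabulary) (M : structure V) (g : M -> M) :
    Prop :=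
  [/\ bijective g,
      forall (f : fun_symb V) (t : (fun_arity f).-tuple M),
        g (fun_interp M f t) = fun_interp M f (map_tuple g t) &
      forall (r : rel_symb V) (t : (rel_arity r).-tuple M),
        rel_interp M r (map_tuple g t) <-> rel_interp M r t].

Definition automorphisms (V : vocabulary) (M : structure V) : set (M -> M) :=
  [set g | is_automorphism g].
Arguments automorphisms {V} M.

(* Main.v *)
(* Let [P_v] send a finite set [A] of nodes to the set of nodes of height [v]
   that lie below an odd number of elements of [A]; it is additive for the
   symmetric difference. The structure consists of a copy of the group of finite
   sets of nodes for each countable ordinal [w], with relations that record the
   translations of each copy and the maps [P_v] from copy [w] to copy [v] for
   [v <= w]. Its automorphisms are the translations by families [g] with
   [g v = P_v (g w)] for [v <= w]. The cardinality of [g w] is nondecreasing in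
   [w], hence eventually constant because omega_1 has uncountable cofinality;
   from then on the elements of [g w] are the points at height [w] of finitely
   many fixed uncountable branches. So automorphisms correspond to finite sets
   of uncountable branches, and there are as many of them as branches, since
   [X * X] injects into [X] for every infinite [X]. *)

From HB Require Import structures.
Require Import Defs.
From mathcomp Require Import all_boot all_order.
From mathcomp Require Import finmap.
From mathcomp Require Import boolp classical_sets functions cardinality wochoice.

Set Implicit Arguments.
Unset Strict Implicit.
Unset Printing Implicit Defensive.

Import Order.TTheory.
Local Open Scope classical_set_scope.
Local Open Scope card_scope.

(** * Cardinal arithmetic *)

(** Choosing values along [R] gives an injection on [A]. A nonempty [A] provides a default value
    [b0] outside it, so [U] need not be pointed. *)
Lemma rel_card_le (T U : Type) (A : set T) (B : set U) (R : T -> U -> Prop) :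
  (forall a, A a -> exists2 b, B b & R a b) ->
  (forall a a' b, A a -> A a' -> R a b -> R a' b -> a = a') ->
  A #<= B.
Proof.
move=> totR injR.
have [->|/set0P[a0 Aa0]] := eqVneq A set0; first exact: card_ge0.
have [b0 _ _] := totR _ Aa0.
pose f a := if pselect (exists2 b, B b & R a b) is left e
            then projT1 (cid2 e) else b0.
have fP a : A a -> B (f a) /\ R a (f a).
  by move=> /totR Ra; rewrite /f; case: pselect => // e; case: cid2.
have [g] : $|{injfun A >-> B}|.
  apply/injfunPex; exists f => [a /fP[]//|a a'].
  rewrite !inE => Aa Aa' faa'; apply: (injR _ _ (f a)) => //.
    exact: (fP _ Aa).2.
  by rewrite faa'; exact: (fP _ Aa').2.
exact: inj_card_le g.
Qed.

Lemma card_le_fun (T U : Type) (A : set T) (B : set U) (u : U) :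
  A #<= B -> exists f : T -> U,
    (forall a, A a -> B (f a)) /\
    (forall a a', A a -> A a' -> f a = f a' -> a = a').
Proof.
pose pU : pointedType :=
  HB.pack U (gen_eqMixin U) (gen_choiceMixin U) (isPointed.Build U u).
move=> /(@pcard_leP _ pU)/injfunPex[f fAB fI]; exists f; split=> // a a' Aa Aa' e.
by apply: fI; rewrite ?inE.
Qed.

Lemma inj_card_leT (T U : Type) (f : T -> U) :
  injective f -> [set: T] #<= [set: U].
Proof.
move=> fI; apply: (@rel_card_le _ _ _ _ (fun x y => y = f x)) => [a _|].
  by exists (f a).
by move=> a a' b _ _ -> /fI.
Qed.

Lemma card_leT_inj (T U : Type) :
  [set: T] #<= [set: U] -> exists f : T -> U, injective f.
Proof.
move=> TU; have [[t]|T0] := pselect (inhabited T).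
  have [E|/set0P[u _]] := eqVneq [set: U] set0.
    move: TU; rewrite E card_le0 => /eqP E'.
    by have : [set: T] t by []; rewrite E'.
  by have [f [_ fI]] := card_le_fun u TU; exists f => x y; exact: fI.
have f : T -> U by move=> x; case: T0.
by exists f => x; case: T0.
Qed.

(** Zorn's lemma yields a maximal graph of a partial bijection. If it missed both some [a] in [A]
    and some [b] in [B], the pair [(a, b)] could be added. *)
Lemma card_le_total (T U : Type) (A : set T) (B : set U) : A #<= B \/ B #<= A.
Proof.
pose P (G : set (T * U)) :=
  (forall p, G p -> A p.1 /\ B p.2) /\
  (forall p q, G p -> G q -> p.1 = q.1 <-> p.2 = q.2).
have [F FP totF|G [[GAB GI] Gmax]] := @Zorn_bigcup _ P.
  split=> [p [G /FP[+ _] Gp]|p q [G FG Gp] [H FH Hq]]; first exact.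
  have [/(_ _ Gp) Hp|/(_ _ Hq) Gq] := totF _ _ FG FH.
    by have [_] := FP _ FH; exact.
  by have [_] := FP _ FG; exact.
have [domG|/existsNP[a /not_implyP[Aa nGa]]] :=
    pselect (forall x, A x -> exists y, G (x, y)).
  left; apply: (@rel_card_le _ _ _ _ (fun x y => G (x, y))).
    by move=> a /domG[b Gab]; exists b => //; have [] := GAB _ Gab.
  by move=> a a' b _ _ Gab Ga'b; have [_] := GI _ _ Gab Ga'b; exact.
have [ranG|/existsNP[b /not_implyP[Bb nGb]]] :=
    pselect (forall y, B y -> exists x, G (x, y)).
  right; apply: (@rel_card_le _ _ _ _ (fun y x => G (x, y))).
    by move=> y /ranG[x Gxy]; exists x => //; have [] := GAB _ Gxy.
  by move=> y y' x _ _ Gxy Gxy'; have [+ _] := GI _ _ Gxy Gxy'; exact.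
exfalso; apply: (Gmax (G `|` [set (a, b)])).
  split; first by move=> p; left.
  by move=> /(_ (a, b) (or_intror erefl)) Gab; apply: nGa; exists b.
split=> [p [/GAB//|->//]|p q].
have nE (p' : T * U) : G p' -> (p'.1 = a <-> p'.2 = b).
  case: p' => x y Gxy /=; split=> E; rewrite E in Gxy; exfalso.
    by apply: nGa; exists y.
  by apply: nGb; exists x.
move=> [Gp|->] [Gq|->] //=; first exact: GI.
  exact: nE.
by have [h1 h2] := nE _ Gq; split=> E; symmetry; [apply: h1|apply: h2].
Qed.

(** * Squares of infinite sets *)

Section InfiniteSquare.
Variable X : Type.

Let dom (G : set (X * X * X)) : set X := [set x | exists z, G (x, x, z)].

(* [G] contains the graph of an injection of the square of [dom G] into [dom G].
   It need not be functional: values are only chosen for a maximal [G]. *)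
Let good (G : set (X * X * X)) := [/\
  forall x y z, G (x, y, z) -> [/\ dom G x, dom G y & dom G z],
  forall x y, dom G x -> dom G y -> exists z, G (x, y, z) &
  forall p q z, G (p, z) -> G (q, z) -> p = q].

Let dom_sub (G H : set (X * X * X)) : G `<=` H -> dom G `<=` dom H.
Proof. by move=> GH x [z /GH Hx]; exists z. Qed.

Let good_bigcup (F : set (set (X * X * X))) :
  F `<=` good -> total_on F subset -> good (\bigcup_(G in F) G).
Proof.
move=> Fg totF; have sub G : F G -> G `<=` \bigcup_(G in F) G.
  by move=> FG p Gp; exists G.
split.
- move=> x y z [G FG /((let: And3 h _ _ := Fg _ FG in h))[dx dy dz]].
  by split; apply: (dom_sub (sub _ FG)).
- move=> x y [z [G FG Gx]] [z' [H FH Hy]].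
  have dx : dom G x by exists z.
  have dy : dom H y by exists z'.
  have [GH|HG] := totF _ _ FG FH.
    have [_ /(_ x y (dom_sub GH dx) dy)[t Ht] _] := Fg _ FH.
    by exists t; exists H.
  have [_ /(_ x y dx (dom_sub HG dy))[t Ht] _] := Fg _ FG.
  by exists t; exists G.
- move=> p q z [G FG Gp] [H FH Hq].
  have [/(_ _ Gp) Hp|/(_ _ Hq) Gq] := totF _ _ FG FH.
    by have [_ _] := Fg _ FH; apply; eassumption.
  by have [_ _] := Fg _ FG; apply; eassumption.
Qed.

Let good_max (G0 : set (X * X * X)) : good G0 ->
  exists G, [/\ good G, G0 `<=` G & forall H, good H -> G `<=` H -> H `<=` G].
Proof.
(* [G0] is built into the property because Zorn's lemma also ranges over the empty chain, whose
   union is empty. *)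
move=> G0g; pose P G := good (G `|` G0).
have [F FP totF|G [PG Gmax]] := @Zorn_bigcup _ P.
  rewrite /P; have -> : \bigcup_(G in F) G `|` G0 =
     \bigcup_(G in [set G `|` G0 | G in F] `|` [set G0]) G.
    apply/seteqP; split=> [p [[G FG Gp]|G0p]|p [_ [[G FG <-]|->]]].
    - by exists (G `|` G0); [left; exists G|left].
    - by exists G0 => //; right.
    - by case=> Gp; [left; exists G|right].
    - by right.
  apply: good_bigcup => [_ [[G /FP ? <-]|->]//|].
  move=> _ _ [[G FG <-]|->] [[H FH <-]|->]; last by left.
  - by have [GH|HG] := totF _ _ FG FH; [left|right]; apply: setSU.
  - by right=> p; right.
  - by left=> p; right.
exists (G `|` G0); split=> //.
move=> H Hg GH p Hp.
apply: contrapT => nGp; apply: (Gmax H).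
  split=> [q Gq|/(_ _ Hp) Gp]; first by apply: GH; left.
  by apply: nGp; left.
by rewrite /P setUidl // => q G0q; apply: GH; right.
Qed.

(** Starting point for the maximal [G]: a pairing function on a copy of [nat]. Its domain provides
    the three distinct tags. *)
Let good_nat (e : nat -> X) : injective e ->
  good [set t | exists m n, t = (e m, e n, e (choice.pickle (m, n)))].
Proof.
move=> eI; set G := [set t | _].
have Gd n : dom G (e n) by exists (e (choice.pickle (n, n))), n, n.
split=> [x y z [m [n [-> -> ->]]]//|x y [_ [m [_ [-> _ _]]]] [_ [n [_ [-> _ _]]]]|].
  by exists (e (choice.pickle (m, n))), m, n.
move=> p q z [m [n [-> ->]]] [m' [n' [-> /eI]]].
by move=> /(pcan_inj choice.pickleK)[-> ->].
Qed.

(* [h] copies [dom G] outside itself. The parts of the square of the union that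
   are new are sent into the copy, the tags [a], [b], [c] keeping their images
   apart. *)
Let good_extend (G : set (X * X * X)) (a b c : X) (q : X -> X -> X) (h : X -> X) :
  good G -> dom G a -> dom G b -> dom G c -> a <> b -> a <> c -> b <> c ->
  (forall x y, dom G x -> dom G y -> G (x, y, q x y)) ->
  (forall x, dom G x -> ~ dom G (h x)) ->
  (forall x y, dom G x -> dom G y -> h x = h y -> x = y) ->
  good (G `|` [set t | exists x y, [/\ dom G x, dom G y & 
     [\/ t = (x, h y, h (q a (q x y))),
         t = (h x, y, h (q b (q x y))) |
         t = (h x, h y, h (q c (q x y)))]]]).
Proof.
move=> [Gc Gt Gi] Da Db Dc ab ac bc Gq hN hI; set N := [set t | _].
have Dq x y : dom G x -> dom G y -> dom G (q x y).
  by move=> dx dy; have [] := Gc _ _ _ (Gq _ _ dx dy).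
have qI x y x' y' : dom G x -> dom G y -> dom G x' -> dom G y' ->
    q x y = q x' y' -> x = x' /\ y = y'.
  move=> dx dy dx' dy' E; have := Gq _ _ dx' dy'; rewrite -E => H.
  by have [] := Gi _ _ _ (Gq _ _ dx dy) H.
have dG x : dom G x -> dom (G `|` N) x by case=> z; exists z; left.
have dh x : dom G x -> dom (G `|` N) (h x).
  move=> dx; exists (h (q c (q x x))); right; exists x, x.
  by split=> //; constructor 3.
have dE x : dom (G `|` N) x -> dom G x \/ exists2 y, dom G y & x = h y.
  case=> z [Gx|[y [y' [dy dy' [][xE xE' _]]]]]; first by left; exists z.
  - by left; rewrite xE.
  - by left; rewrite xE'.
  - by right; exists y.
split.
- move=> x y z [/Gc[/dG ? /dG ? /dG ?]//|[u [v [du dv]]]].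
  case=> -[-> -> ->]; split; try exact/dG;
    apply/dh => //; apply/Dq => //; exact/Dq.
- move=> x y /dE[dx|[u du ->]] /dE[dy|[v dv ->]].
  + by have [z] := Gt _ _ dx dy; exists z; left.
  + by exists (h (q a (q x v))); right; exists x, v; split=> //; constructor 1.
  + by exists (h (q b (q u y))); right; exists u, y; split=> //; constructor 2.
  + by exists (h (q c (q u v))); right; exists u, v; split=> //; constructor 3.
have NE p z : N (p, z) -> exists k x y, [/\ dom G k, dom G x, dom G y,
    z = h (q k (q x y)) & [\/ k = a /\ p = (x, h y), k = b /\ p = (h x, y) |
       k = c /\ p = (h x, h y)]].
  case=> x [y [dx dy [][-> ->]]].
  - by exists a, x, y; split=> //; constructor 1.
  - by exists b, x, y; split=> //; constructor 2.
  - by exists c, x, y; split=> //; constructor 3.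
(* Old values lie in [dom G] and new ones in the copy outside it, so they never collide. *)
have nGN p p' z : G (p, z) -> N (p', z) -> False.
  case: p => u v /Gc[_ _ dz] /NE[k [x [y [dk dx dy E _]]]].
  by move: dz; rewrite E; apply: hN; do ?apply/Dq.
move=> p p' z [Gp|Np] [Gp'|Np'].
- exact: Gi Gp Gp'.
- by case: (nGN _ _ _ Gp Np').
- by case: (nGN _ _ _ Gp' Np).
have [k [x [y [dk dx dy zE H]]]] := NE _ _ Np.
have [k' [x' [y' [dk' dx' dy' + H']]]] := NE _ _ Np'.
rewrite zE => /hI => E.
have {}E := E (Dq _ _ dk (Dq _ _ dx dy)) (Dq _ _ dk' (Dq _ _ dx' dy')).
have [Ek Exy] := qI _ _ _ _ dk (Dq _ _ dx dy) dk' (Dq _ _ dx' dy') E.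
have [Ex Ey] := qI _ _ _ _ dx dy dx' dy' Exy; subst k' x' y'.
by case: H => -[? ->]; case: H' => -[? ->] //; subst k; congruence.
Qed.

(** Let [D] be the domain of a maximal [G]. An injection of [D] into its complement would allow an
    extension of [G], so the complement injects into [D]. Then [X] injects into [D] as well, and the
    square of [D] injects into [D]. *)
Lemma infinite_square : infinite_set [set: X] ->
  [set: X * X] #<= [set: X].
Proof.
move=> /infiniteP/card_leT_inj[e eI].
have [G [Gg G0G Gmax]] := good_max (good_nat eI).
have De n : dom G (e n).
  by exists (e (choice.pickle (n, n))); apply: G0G; exists n, n.
have [Gc Gt Gi] := Gg.
have /choice[q' Gq'] : forall p : X * X, exists z,
    dom G p.1 -> dom G p.2 -> G (p, z).
  case=> x y /=; have [dx|?] := pselect (dom G x); last by exists (e 0).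
  have [dy|?] := pselect (dom G y); last by exists (e 0).
  by have [z] := Gt _ _ dx dy; exists z.
pose q x y := q' (x, y).
have Gq x y : dom G x -> dom G y -> G (x, y, q x y) by move=> *; exact: Gq'.
have Dq x y : dom G x -> dom G y -> dom G (q x y).
  by move=> dx dy; have [] := Gc _ _ _ (Gq _ _ dx dy).
have qI x y x' y' : dom G x -> dom G y -> dom G x' -> dom G y' ->
    q x y = q x' y' -> x = x' /\ y = y'.
  move=> dx dy dx' dy' E; have := Gq _ _ dx' dy'; rewrite -E => H.
  by have [] := Gi _ _ _ (Gq _ _ dx dy) H.
have eN m n : m != n -> e m <> e n by move=> /eqP mn /eI.
have [/(card_le_fun (e 0))[h [hN hI]]|/(card_le_fun (e 0))[k [kD kI]]] :=
    card_le_total (dom G) (~` dom G).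
  have Hg := good_extend Gg (De 0) (De 1) (De 2)
    (eN 0 1 isT) (eN 0 2 isT) (eN 1 2 isT) Gq hN hI.
  (* By maximality this new triple is already in [G], although [h (e 0)] is outside the domain. *)
  have /Gc[_ dh _] : G (e 0, h (e 0), h (q (e 0) (q (e 0) (e 0)))).
    apply: (Gmax _ Hg); first by move=> ?; left.
    by right; exists (e 0), (e 0); split=> //; constructor 1.
  by case: (hN _ (De 0)).
(* The tags [e 0] and [e 1] keep the images of [dom G] and of its complement disjoint. *)
pose j x := if pselect (dom G x) then q (e 0) x else q (e 1) (k x).
have Dj x : dom G (j x).
  by rewrite /j; case: pselect => ?; apply: Dq => //; exact: kD.
have jI : injective j.
  move=> x y; rewrite /j; case: pselect => dx; case: pselect => dy.
  - by case/qI.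
  - by case/qI => //; [exact: kD|move/eI].
  - by case/qI => //; [exact: kD|move/eI].
  - by case/qI => //; try exact: kD; move=> _; exact: kI.
apply: (@inj_card_leT _ _ (fun p => q (j p.1) (j p.2))) => -[x y] [x' y'] /=.
by case/qI => // /jI-> /jI->.
Qed.

End InfiniteSquare.

(** Iterated pairing codes a list. The length is stored too, since lists of different lengths may
    share a code. *)
Lemma card_seq_le (X : Type) : infinite_set [set: X] ->
  [set: seq X] #<= [set: X].
Proof.
move=> Xinf; have /card_leT_inj[e eI] := (infiniteP _).1 Xinf.
have /card_leT_inj[p pI] := infinite_square Xinf.
pose code := foldr (fun x y => p (x, y)) (e 0).
have codeI s t : size s = size t -> code s = code t -> s = t.
  by elim: s t => [|x s IH] [|y t] //= [st] /pI[-> /(IH _ st)->].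
apply: (@inj_card_leT _ _ (fun s => p (e (size s), code s))) => s t.
by move=> /pI[/eI]; exact: codeI.
Qed.

(** * Heights and threads *)

Local Open Scope order_scope.

Section Omega1.
Context (dW : Order.disp_t) (W : orderType dW) (W1 : is_omega1 W).

Lemma omega1_min (A : set W) : A !=set0 ->
  exists2 m, A m & forall x, A x -> m <= x.
Proof.
move=> [x Ax]; have [+ _ _] := W1.
have neA : wochoice.nonempty (mem A) by exists x; rewrite inE.
move=> /(_ _ neA)[m [[mA mmin] _]]; exists m; first by rewrite inE in mA.
by move=> y Ay; apply: mmin; rewrite inE.
Qed.

(** If [s] were unbounded, with [s (u n) > n], every [w] would lie below [u (s w)], making [W] a
    countable union of countable segments. So [s] is bounded, and it stays constant once its maximum
    is reached. *)
Lemma omega1_eventually_constant (s : W -> nat) :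
  (forall v w, v <= w -> (s v <= s w)%N) ->
  exists w0, forall w, w0 <= w -> s w = s w0.
Proof.
move=> s_homo; have [_ W_unc W_cnt] := W1.
have [N sN] : exists N, forall w, (s w <= N)%N.
  apply: contrapT => /forallNP s_unb.
  have /choice[u uP] : forall n, exists w, (n < s w)%N.
    by move=> n; have /existsNP[w /negP] := s_unb n; rewrite -ltnNge; exists w.
  apply: W_unc; have -> : [set: W] = \bigcup_n below (u n).
    apply/seteqP; split=> // w _; exists (s w) => //; rewrite /below /= ltNge.
    by apply/negP => /s_homo; rewrite leqNgt uP.
  by apply: bigcup_countable => // n _; exact: W_cnt.
have [[w _]|W0] := pselect (exists w : W, True); last first.
  by exfalso; apply: W_unc; have -> : [set: W] = set0;
    [apply/seteqP; split=> // w _; apply: W0; exists w|exact: countable0].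
pose P n := `[< exists w, s w = n >].
have exP : exists n, P n by exists (s w); apply/asboolP; exists w.
have ubP n : P n -> (n <= N)%N by move=> /asboolP[v <-].
case: (ex_maxnP exP ubP) => _ /asboolP[w0 <-] s_max; exists w0 => v w0v.
apply/eqP; rewrite eqn_leq (s_homo _ _ w0v) andbT s_max //.
by apply/asboolP; exists v.
Qed.

Lemma omega1_infinite : infinite_set [set: W].
Proof. by have [_ + _] := W1 => + /finite_set_countable; apply. Qed.

End Omega1.

Section Levels.
Context (d dW : Order.disp_t) (T : porderType d) (W : orderType dW).
Hypothesis W1 : is_omega1 W.

(** For isomorphisms [g] onto [below a] and [f] onto [below b] with [b < a], take the least value
    [g y] with [f y < g y]. The node [y'] with [g y' = f y] lies below [y], hence [f y' < g y'],
    against minimality. *)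
Lemma level_unique (x : T) (u v : W) : level T u x -> level T v x -> u = v.
Proof.
suff nlt (a b : W) : level T a x -> level T b x -> b < a -> False.
  move=> xu xv; have [uv|vu|//] := ltgtP u v.
    by case: (nlt _ _ xv xu uv).
  by case: (nlt _ _ xu xv vu).
move=> [g [[gx gI gS] gm]] [f [[fx fI fS] fm]] ba.
have gS' w : w < a -> exists2 y, y < x & g y = w by move=> wa; exact: (gS w wa).
have gm' := leW_mono_in gm; have fm' := leW_mono_in fm.
have [|m [y yx [gy fy]] mmin] :=
    omega1_min W1 (A := [set w | exists2 y, y < x & g y = w /\ f y < w]).
  by have [y yx gy] := gS' _ ba; exists b, y => //; split=> //; exact: fx.
have [y' y'x gy'] := gS' (f y) (lt_trans (fx _ yx) ba).
have := mmin (f y); rewrite leNgt fy => /(_ _)/negP; apply=> //.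
exists y' => //; split=> //; rewrite fm' ?inE //.
by rewrite -gm' ?inE // gy' gy.
Qed.

Lemma level_restrict (f : T -> W) (x y : T) (w : W) :
  set_bij (below y) (below w) f -> {in below y &, {mono f : a b / a <= b}} ->
  x < y -> level T (f x) x.
Proof.
move=> [fy fI fS] fm xy; have fm' := leW_mono_in fm.
have sub : below x `<=` below y by move=> z /lt_trans; exact.
exists f; split; last first.
  by move=> a b; rewrite !inE => /sub ? /sub ?; apply: fm; rewrite inE.
split=> [z zx|a b|w' w'x].
- by rewrite /below /= fm' ?inE //; exact: sub.
- by rewrite !inE => /sub ? /sub ?; apply: fI; rewrite inE.
- have [z zy zw'] := fS w' (lt_trans w'x (fy _ xy)).
  by exists z => //; move: w'x; rewrite /below /= -zw' fm' ?inE.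
Qed.

(** The last three properties are all that the study of threads and coherent families uses about the
    tree; the first ties [ht] to the levels. *)
Lemma exists_height : is_tree T -> has_height T W ->
  exists ht : T -> W, [/\
    forall x, level T (ht x) x,
    forall x y : T, x < y -> ht x < ht y,
    forall (w : W) (x : T), w <= ht x -> exists2 y, y <= x & ht y = w &
    forall x y z : T, y <= x -> z <= x -> (y <= z) || (z <= y)].
Proof.
move=> treeT [_ /choice[ht htP]]; exists ht; split=> //.
- move=> x y xy; have [f [fb fm]] := htP y.
  rewrite (level_unique (htP x) (level_restrict fb fm xy)).
  by have [fy _ _] := fb; exact: fy.
- move=> w x; rewrite le_eqVlt => /predU1P[->|wx]; first by exists x.
  have [f [fb fm]] := htP x; have [_ _ fS] := fb.
  have [y yx fy] := fS _ wx; exists y; first exact: ltW.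
  by rewrite (level_unique (htP y) (level_restrict fb fm yx)).
- move=> x y z; rewrite !le_eqVlt => /predU1P[->|yx] /predU1P[->|zx].
  + by rewrite eqxx.
  + by rewrite zx !orbT.
  + by rewrite yx !orbT.
  + by rewrite -!le_eqVlt; exact: (wo_chainW (treeT x)).
Qed.

End Levels.

(** * Uncountable branches as threads *)

Section Threads.
Context (d dW : Order.disp_t) (T : porderType d) (W : orderType dW).
Hypothesis W1 : is_omega1 W.
Variable ht : T -> W.
Hypothesis ht_lt : forall x y : T, x < y -> ht x < ht y.
Hypothesis ht_onto :
  forall (w : W) (x : T), w <= ht x -> exists2 y, y <= x & ht y = w.
Hypothesis chain_below :
  forall x y z : T, y <= x -> z <= x -> (y <= z) || (z <= y).

Lemma ht_comparable_inj (x y : T) : (x <= y) || (y <= x) -> ht x = ht y -> x = y.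
Proof.
by rewrite !le_eqVlt => /orP[] /predU1P[->//|/ht_lt + E]; rewrite E ltxx.
Qed.

Lemma ht_le (x y : T) : x <= y -> ht x <= ht y.
Proof. by rewrite le_eqVlt => /predU1P[->//|/ht_lt/ltW]. Qed.

Lemma ht_below_inj (x y z : T) : y <= x -> z <= x -> ht y = ht z -> y = z.
Proof. by move=> yx zx; apply: ht_comparable_inj; exact: chain_below yx zx. Qed.

(* The junk value is [x], when [ht x < w]. *)
Definition trunc (w : W) (x : T) : T :=
  if pselect (exists2 y, y <= x & ht y = w) is left e then projT1 (cid2 e)
  else x.

Lemma truncP (w : W) (x : T) : w <= ht x -> trunc w x <= x /\ ht (trunc w x) = w.
Proof.
by move=> /ht_onto e; rewrite /trunc; case: pselect => // e'; case: cid2.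
Qed.

Lemma trunc_uniq (x y : T) : y <= x -> trunc (ht y) x = y.
Proof.
by move=> yx; have [yx' E] := truncP (ht_le yx); exact: ht_below_inj yx' yx E.
Qed.

(** Uncountable branches, each presented by its enumeration by height. *)
Definition threads : set (W -> T) :=
  [set b | (forall w, ht (b w) = w) /\ forall v w, v <= w -> b v <= b w].

(** A node comparable with the whole range equals the member of its own height, so the range is
    maximal. Heights also recover the thread from its range. *)
Lemma threads_le_branches : threads #<= uncountable_branches T.
Proof.
apply: (@rel_card_le _ _ _ _ (fun b B => B = range b)); last first.
  move=> b b' _ [bh _] [bh' _] -> E; apply/funext => w.
  have : range b (b w) by exists w.
  by rewrite E => -[v _ bv]; rewrite -bv; congr b'; rewrite -(bh w) -bv bh'.
move=> b [bh b_homo]; exists (range b) => //; have bc : is_chain (range b).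
  move=> _ _ [v _ <-] [w _ <-].
  by have [vw|/ltW wv] := leP v w; [left|right]; exact: b_homo.
split.
  split=> // C Cc bC; apply/seteqP; split=> // x Cx; exists (ht x) => //.
  apply: ht_comparable_inj; last exact: bh.
  by apply/orP; apply: Cc => //; apply: bC; exists (ht x).
have [_ W_unc _] := W1; apply: contra_not W_unc; apply: sub_countable.
apply: (@rel_card_le _ _ _ _ (fun w x => x = b w)) => [w _|v w x _ _ -> E].
  by exists (b w) => //; exists w.
by rewrite -(bh v) E bh.
Qed.

(** Maximality makes [B] closed downwards, and uncountability makes it meet every level, in one node
    because [B] is a chain. *)
Lemma branch_thread (B : set T) : uncountable_branches T B ->
  exists2 b, threads b & B = range b.
Proof.
move=> [[Bc Bmax] B_unc].
have B_down x y : B x -> y <= x -> B y.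
  move=> Bx yx; rewrite -(Bmax (B `|` [set y])); [by right| |by move=> z; left].
  have cmp z : B z -> (z <= y) || (y <= z).
    move=> Bz; have [zx|xz] := Bc _ _ Bz Bx; first exact: chain_below zx yx.
    by rewrite (le_trans yx xz) orbT.
  move=> z z' [Bz|->] [Bz'|->]; [exact: Bc|exact/orP/cmp|
    by apply/orP; rewrite orbC; exact: cmp|by left].
have ht_inj x y : B x -> B y -> ht x = ht y -> x = y.
  by move=> Bx By; apply: ht_comparable_inj; exact/orP/Bc.
have /choice[u uP] : forall w, exists x, B x /\ ht x = w.
  (* If height [w] were missing, downward closure would keep all heights in [B] below [w], and [ht]
     would inject [B] into a countable segment. *)
  move=> w; apply: contrapT => /forallNP Bw; apply: B_unc.
  have [_ _ W_cnt] := W1; apply: sub_countable (W_cnt w).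
  apply: (@rel_card_le _ _ _ _ (fun x v => v = ht x)) => [x Bx|x y v Bx By ->].
    exists (ht x) => //; rewrite /below /= ltNge; apply/negP => /ht_onto[y yx yw].
    by apply: (Bw y); split=> //; exact: B_down yx.
  exact: ht_inj.
exists u.
  split=> [w|v w vw]; first exact: (uP w).2.
  have [//|] := Bc _ _ (uP v).1 (uP w).1; rewrite le_eqVlt => /predU1P[->//|].
  by move=> /ht_lt; rewrite (uP v).2 (uP w).2 ltNge vw.
apply/seteqP; split=> [x Bx|_ [w _ <-]]; last exact: (uP w).1.
by exists (ht x) => //; apply: ht_inj; rewrite ?(uP _).2 //; exact: (uP _).1.
Qed.

Lemma card_threads : threads #= uncountable_branches T.
Proof.
apply: Cantor_Bernstein; first exact: threads_le_branches.
apply: (@rel_card_le _ _ _ _ (fun B b => B = range b)) => [B|B B' b _ _ -> //].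
exact: branch_thread.
Qed.

End Threads.

(** * Coherent families of finite sets *)

Section FsetParity.
Context (K : choiceType).
Implicit Types (A B : {fset K}) (U : pred K).

Definition symdiff A B : {fset K} := ((A `\` B) `|` (B `\` A))%fset.

Lemma in_symdiff A B x : (x \in symdiff A B) = (x \in A) (+) (x \in B).
Proof. by rewrite !inE; case: (x \in A); case: (x \in B). Qed.

Lemma symdiffA A B C : symdiff A (symdiff B C) = symdiff (symdiff A B) C.
Proof. by apply/fsetP => x; rewrite !in_symdiff addbA. Qed.

Lemma symdiff0 A : symdiff A fset0 = A.
Proof. by apply/fsetP => x; rewrite in_symdiff in_fset0 addbF. Qed.

Lemma symdiffK A : involutive (symdiff A).
Proof. by move=> B; apply/fsetP => x; rewrite !in_symdiff addKb. Qed.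

Lemma symdiffC A B : symdiff A B = symdiff B A.
Proof. by apply/fsetP => x; rewrite !in_symdiff addbC. Qed.

Definition parity U A : bool := \big[addb/false]_(x <- A) U x.

(** Brings parities of different sets to one index set, where they can be added termwise. *)
Lemma parity_sub U A B : (A `<=` B)%fset ->
  parity U A = \big[addb/false]_(x <- B) ((x \in A) && U x).
Proof.
move=> AB; rewrite -(big_fset_incl addb AB) => [|x _ /negbTE-> //].
by apply: eq_big_seq => x ->.
Qed.

Lemma parity_symdiff U A B :
  parity U (symdiff A B) = parity U A (+) parity U B.
Proof.
have sAB : (symdiff A B `<=` A `|` B)%fset.
  apply/fsubsetP => x; rewrite in_symdiff inE.
  by case: (x \in A); case: (x \in B).
rewrite (parity_sub U sAB) (parity_sub U (fsubsetUl A B)).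
rewrite (parity_sub U (fsubsetUr A B)) -big_split; apply: eq_bigr => x _.
by rewrite in_symdiff andb_addl.
Qed.

Lemma parity_has U A : parity U A -> exists2 x, x \in A & U x.
Proof.
move=> pA; apply: contrapT => nA; move: pA; rewrite /parity big_seq big1 //.
by move=> x xA; apply/negP => Ux; apply: nA; exists x.
Qed.

Lemma parity1 U x : parity U [fset x]%fset = U x.
Proof. by rewrite /parity big_seq_fset1. Qed.

End FsetParity.

Section CoherentFamilies.
Context (d dW : Order.disp_t) (T : porderType d) (W : orderType dW).
Hypothesis W1 : is_omega1 W.
Variable ht : T -> W.
Hypothesis ht_lt : forall x y : T, x < y -> ht x < ht y.
Hypothesis ht_onto :
  forall (w : W) (x : T), w <= ht x -> exists2 y, y <= x & ht y = w.
Hypothesis chain_below :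
  forall x y z : T, y <= x -> z <= x -> (y <= z) || (z <= y).

Let tr := trunc ht.
Let trP u w x : ht x = u -> w <= u -> tr w x <= x /\ ht (tr w x) = w.
Proof. by move=> <-; exact: truncP. Qed.
Let tr_uniq := trunc_uniq ht_lt ht_onto chain_below.
Let below_inj := ht_below_inj ht_lt chain_below.

(** The map [P_v]. The truncations form a finite set to select from: a node of height [v] below an
    odd number of elements of [A] is below one of them, hence is its truncation. *)
Definition proj (v : W) (A : {fset T}) : {fset T} :=
  [fset y in [fset tr v x | x in A] |
    (ht y == v) && parity (fun x => y <= x) A]%fset.

Lemma in_proj v A y :
  (y \in proj v A) = (ht y == v) && parity (fun x => y <= x) A.
Proof.
rewrite !inE /= andb_idl // => /andP[/eqP hy /parity_has[x xA yx]].
by apply/imfsetP; exists x => //; rewrite -hy; exact/esym/tr_uniq.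
Qed.

Lemma proj_symdiff v A B : proj v (symdiff A B) = symdiff (proj v A) (proj v B).
Proof.
by apply/fsetP => y; rewrite in_symdiff !in_proj parity_symdiff andb_addr.
Qed.

(** The case [v = w] forces all nodes of [g w] to have height [w]. *)
Definition coherent : set (W -> {fset T}) :=
  [set g | forall v w, v <= w -> g v = proj v (g w)].

(** A thread is sent to the family of its singletons. *)
Lemma threads_le_coherent : threads ht #<= coherent.
Proof.
apply: (@rel_card_le _ _ _ _ (fun b g => g = fun w => [fset b w]%fset)).
  move=> b [bh b_homo]; exists (fun w => [fset b w]%fset) => // v w vw.
  apply/fsetP => y; rewrite in_proj parity1 inE.
  apply/eqP/andP => [->|[/eqP yv yw]].
    by rewrite bh eqxx b_homo.
  by apply: (below_inj yw (b_homo _ _ vw)); rewrite bh.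
move=> b b' g _ _ -> E; apply/funext => w.
by apply/fset1P; rewrite -[[fset _]%fset](congr1 (@^~ w) E) fset11.
Qed.

(** Truncation to height [v] maps [g w] onto a superset of [g v]. Once cardinalities are constant it
    is a bijection from [g w] to [g v], so each node of [g w0] extends upwards to a thread. *)
Lemma coherent_support (g : W -> {fset T}) : coherent g ->
  exists (s : seq (set_type (threads ht))) (w0 : W),
    forall w, w0 <= w -> g w =i [seq val b w | b <- s].
Proof.
move=> gc.
have g_ht w x : x \in g w -> ht x = w.
  by rewrite (gc w w) // in_proj => /andP[/eqP].
have g_sub v w : v <= w -> (g v `<=` [fset tr v x | x in g w])%fset.
  by move=> vw; rewrite [g v](gc v w) //; exact: fset_sub.
have [v w vw|w0 gw0] := omega1_eventually_constant W1 (s := fun w => #|` g w|).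
  exact: leq_trans (fsubset_leq_card (g_sub _ _ vw)) (leq_imfset_card _ _ _).
have g_card v w : w0 <= v -> v <= w -> #|` g w| = #|` g v|.
  by move=> wv vw; rewrite !gw0 // (le_trans wv).
have g_im v w : w0 <= v -> v <= w -> [fset tr v x | x in g w]%fset = g v.
  move=> wv vw; apply/eqP; rewrite eq_sym eqEfcard g_sub //=.
  by rewrite -(g_card v w wv vw); exact: leq_imfset_card.
have tr_inj v w : w0 <= v -> v <= w -> {in g w &, injective (tr v)}.
  by move=> wv vw; apply/card_in_imfsetP; rewrite g_im // -(g_card v w wv vw).
have g_tr v w x : w0 <= v -> v <= w -> x \in g w -> tr v x \in g v.
  by move=> wv vw xg; rewrite -(g_im v w) // in_imfset.
have thr x : x \in g w0 -> exists b : set_type (threads ht),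
    val b w0 = x /\ forall w, w0 <= w -> val b w \in g w.
  move=> xg; have hx := g_ht _ _ xg.
  have /choice[z zP] : forall w, exists z, w0 <= w -> z \in g w /\ tr w0 z = x.
    move=> w; have [w0w|_] := boolP (w0 <= w); last by exists x.
    by move: xg; rewrite -(g_im w0 w) // => /imfsetP[z zg ->]; exists z.
  (* The maximum avoids the default values of [z] below [w0]; [b] later truncates back to height
     [w]. *)
  pose z' w := z (Order.max w w0).
  have z'g w : z' w \in g (Order.max w w0).
    by have [] := zP (Order.max w w0) _; rewrite // le_max lexx orbT.
  have z'x w : tr w0 (z' w) = x.
    by have [] := zP (Order.max w w0) _; rewrite // le_max lexx orbT.
  have z'h w : ht (z' w) = Order.max w w0 by exact: g_ht (z'g w).
  have z'_homo v w : v <= w -> z' v <= z' w.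
    move=> vw; set m := Order.max v w0; set n := Order.max w w0.
    have mn : m <= n by rewrite ge_max !le_max vw lexx orbT.
    have w0m : w0 <= m by rewrite le_max lexx orbT.
    have [le_tr h_tr] := trP (z'h w) mn.
    suff <- : tr m (z' w) = z' v by [].
    (* Both nodes lie in [g m] and truncate to [x] at height [w0], where truncation is injective. *)
    apply: (tr_inj w0 m) => //; first exact: (g_tr _ _ _ w0m mn (z'g w)).
    rewrite z'x; have [le1 h1] := trP h_tr w0m.
    have [le2 h2] := trP (z'h w) (le_trans w0m mn).
    rewrite -(z'x w); apply: (below_inj (le_trans le1 le_tr) le2).
    by rewrite h1 h2.
  pose b w := tr w (z' w).
  have bP w : b w <= z' w /\ ht (b w) = w.
    by apply: trP (z'h w) _; rewrite le_max lexx.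
  have bT : threads ht b.
    split=> [w|v w vw]; first exact: (bP w).2.
    have [le1 h1] := trP (bP w).2 vw.
    suff -> : b v = tr v (b w) by [].
    apply: (below_inj (le_trans (bP v).1 (z'_homo _ _ vw)) (le_trans le1 (bP w).1)).
    by rewrite h1 (bP v).2.
  have bE w : w0 <= w -> b w = z' w.
    move=> w0w; apply: (below_inj (bP w).1 (lexx _)).
    by rewrite (bP w).2 z'h; apply/esym/max_idPl.
  exists (SigSub (mem_set bT)); split=> [|w w0w] /=.
    rewrite bE // -(z'x w0); have := tr_uniq (lexx (z' w0)).
    by rewrite z'h maxxx; exact: esym.
  by rewrite bE //; have := z'g w; have /max_idPl-> := w0w.
(* Options make the choice total even when no thread exists; [pmap] then drops [None]. *)
have /choice[bf bfP] : forall x, exists o, x \in g w0 ->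
    exists b : set_type (threads ht), [/\ o = Some b, val b w0 = x &
      forall w, w0 <= w -> val b w \in g w].
  move=> x.
  have [/thr[b [bx bg]]|_] := boolP (x \in g w0); last by exists None.
  by exists (Some b) => _; exists b.
exists (pmap bf (enum_fset (g w0))), w0 => w w0w y.
apply/idP/mapP => [yg|[b + ->]].
  have xg := g_tr _ _ _ (lexx _) w0w yg.
  have [b [bx bw0 bg]] := bfP _ xg; exists b.
    by rewrite mem_pmap; apply/mapP; exists (tr w0 y).
  apply: (tr_inj w0 w) => //; first exact: bg.
  have [_ b_homo] := set_mem (valP b).
  rewrite -bw0; apply/esym; have := tr_uniq (b_homo _ _ w0w).
  by have [-> _] := set_mem (valP b).
rewrite mem_pmap => /mapP[x xg E].
have [b' [bx _ bg]] := bfP _ xg; move: E; rewrite bx => -[->].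
exact: bg.
Qed.

Lemma coherent_eq (g g' : W -> {fset T}) (w0 : W) :
  coherent g -> coherent g' -> (forall w, w0 <= w -> g w = g' w) -> g = g'.
Proof.
move=> gc gc' E; apply/funext => v; set m := Order.max v w0.
by rewrite (gc v m) ?(gc' v m) ?E // le_max lexx ?orbT.
Qed.

(** A family is coded by any list of threads that traces it eventually. Several lists may serve one
    family, but a list determines the family: its values at large heights project to all others. *)
Lemma coherent_le (L : Type) : infinite_set [set: L] -> threads ht #<= [set: L] ->
  coherent #<= [set: L].
Proof.
move=> Linf thL; apply: card_le_trans (card_seq_le Linf).
have /card_leT_inj[c cI] : [set: set_type (threads ht)] #<= [set: L].
  by rewrite (card_le_eql (card_setT _)).
apply: (@rel_card_le _ _ _ _ (fun g l => exists s w0, l = map c s /\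
    forall w, w0 <= w -> g w =i [seq val b w | b <- s])).
  by move=> g /coherent_support[s [w0 gP]]; exists (map c s) => //; exists s, w0.
move=> g g' _ gc gc' [s [w0 [-> gE]]] [s' [w0' [/(inj_map cI) <- gE']]].
apply: (@coherent_eq _ _ (Order.max w0 w0')) => // w.
rewrite ge_max => /andP[w0w w0'w]; apply/fsetP => y.
by rewrite gE // gE'.
Qed.

End CoherentFamilies.

(** * The structure *)

Section Torsors.
Context (K : choiceType) (d : Order.disp_t) (I : porderType d).
Variable p : I -> {fset K} -> {fset K}.
Hypothesis p_symdiff : forall v A B, p v (symdiff A B) = symdiff (p v A) (p v B).

Let M := (I * {fset K})%type.

Definition torsor_vocabulary := {|
  fun_symb := void; fun_arity := fun=> 0%N;
  rel_symb := M + I * I; rel_arity := fun=> 2%N |}.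

(** Symbols [inl] record translations within one copy and symbols [inr] the graphs of the maps
    [p v]. When [v <= w] fails, [inr (v, w)] denotes the empty relation. *)
Definition torsor_rel (r : M + I * I) (x y : M) : Prop :=
  match r with
  | inl (w, A) => [/\ x.1 = w, y.1 = w & y.2 = symdiff x.2 A]
  | inr (v, w) => [/\ v <= w, x.1 = w, y.1 = v & y.2 = p v x.2]
  end.

Definition torsor_structure : structure torsor_vocabulary :=
  @Structure torsor_vocabulary M (fun f _ => match f with end)
    (fun r => [set t | torsor_rel r (tnth t ord0) (tnth t ord_max)]).

Definition translation (g : I -> {fset K}) (x : M) : M :=
  (x.1, symdiff (g x.1) x.2).

Lemma translationK g : involutive (translation g).
Proof. by case=> w A; rewrite /translation /= symdiffK. Qed.

Lemma automorphism_rel (phi : torsor_structure -> torsor_structure) :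
  is_automorphism phi <->
  bijective phi /\
  forall r x y, torsor_rel r (phi x) (phi y) <-> torsor_rel r x y.
Proof.
split=> [[phi_bij _ phi_rel]|[phi_bij phi_rel]]; split=> //.
- by move=> r x y; have := phi_rel r [tuple x; y].
- by move=> r t; rewrite /= !tnth_map; exact: phi_rel.
Qed.

(** Associativity handles the symbols [inl]; additivity of [p] with the condition on [g] handles
    [inr]. *)
Lemma translation_automorphism (g : I -> {fset K}) :
  (forall v w, v <= w -> g v = p v (g w)) ->
  @is_automorphism _ torsor_structure (translation g).
Proof.
move=> gc; apply/automorphism_rel; split.
  by exists (translation g); exact: translationK.
have sI A : injective (symdiff A) := inv_inj (symdiffK A).
move=> [[w A]|[v w]] [u B] [u' C] /=; split.
- by move=> [-> ->]; rewrite -symdiffA => /sI.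
- by move=> [-> -> ->]; rewrite symdiffA.
- by move=> [vw -> ->]; rewrite p_symdiff -gc // => /sI.
- by move=> [vw -> -> ->]; rewrite p_symdiff -gc.
Qed.

(** The symbol [inl (w, A)] links [(w, fset0)] to [(w, A)], so [phi] preserves copies and is
    determined by the images of the empty sets. As [p v] fixes the empty set, [inr] gives the
    compatibility of these images. *)
Lemma automorphism_translation (phi : torsor_structure -> torsor_structure) :
  is_automorphism phi ->
  exists2 g, (forall v w, v <= w -> g v = p v (g w)) & phi = translation g.
Proof.
move=> /automorphism_rel[_ phi_rel].
pose g w := (phi (w, fset0)).2.
have phiE w A : phi (w, A) = (w, symdiff (g w) A).
  have /phi_rel[] : torsor_rel (inl (w, A)) (w, fset0) (w, A).
    by split=> //=; rewrite symdiffC symdiff0.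
  by rewrite /g; case: (phi (w, A)) => /= ? ? _ -> ->.
exists g; last by apply/funext => -[w A]; exact: phiE.
have p0 v : p v fset0 = fset0.
  have := p_symdiff v fset0 fset0.
  rewrite symdiff0; set P := p v fset0; rewrite -[in LHS](symdiff0 P).
  by move=> /(inv_inj (symdiffK P))<-.
move=> v w vw.
have /phi_rel[_ _ _] : torsor_rel (inr (v, w)) (w, fset0) (v, fset0) by split.
by rewrite !phiE /= !symdiff0.
Qed.

Lemma card_torsor_automorphisms :
  automorphisms torsor_structure #=
  [set g : I -> {fset K} | forall v w, v <= w -> g v = p v (g w)].
Proof.
apply: Cantor_Bernstein.
  apply: (@rel_card_le _ _ _ _ (fun phi g => phi = translation g)).
    by move=> phi /automorphism_translation[g]; exists g.
  by move=> phi phi' g _ _ -> ->.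
apply: (@rel_card_le _ _ _ _ (fun g phi => phi = translation g)) => [g gc|].
  by exists (translation g) => //; exact: translation_automorphism.
move=> g g' phi _ _ -> E; apply/funext => w.
have := congr1 (@^~ (w, fset0)) E.
by rewrite /translation /= !symdiff0 => -[].
Qed.

End Torsors.

Section SmallTree.
Context (T : choiceType) (W : Type).
Hypothesis Winf : infinite_set [set: W].

Lemma card_prod_fset : [set: T] #<= [set: W] -> [set: W * {fset T}] #= [set: W].
Proof.
move=> /card_leT_inj[c cI]; have /card_leT_inj[s sI] := card_seq_le Winf.
apply: Cantor_Bernstein.
  apply: card_le_trans (infinite_square Winf).
  apply: (@inj_card_leT _ _ (fun x => (x.1, s (map c (enum_fset x.2))))).
  move=> [w A] [v B] /= [-> /sI /(inj_map cI) AB]; congr pair.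
  by apply/fsetP => x; rewrite -[x \in A]/(x \in enum_fset A) AB.
by apply: (@inj_card_leT _ _ (fun w => (w, fset0))) => w v [].
Qed.

(** A node is coded by its height together with its code within that level. *)
Lemma card_union_levels (ht : T -> W) :
  (forall w, [set x | ht x = w] #<= [set: W]) -> [set: T] #<= [set: W].
Proof.
move=> htW; apply: card_le_trans (infinite_square Winf).
have /choice[f fP] : forall w, exists f : T -> W, forall x y,
    ht x = w -> ht y = w -> f x = f y -> x = y.
  by move=> w; have [f [_ fI]] := card_le_fun w (htW w); exists f.
apply: (@inj_card_leT _ _ (fun x => (ht x, f (ht x) x))) => x y [hxy].
by rewrite hxy; exact: fP.
Qed.

End SmallTree.

Theorem theorem14 :
  forall (dW : Order.disp_t) (W : orderType dW), is_omega1 W ->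
  forall L : Type,
    card_lt [set: W] [set: L] -> card_lt [set: L] [set: W -> bool] ->
  (exists (d : Order.disp_t) (T : porderType d),
    [/\ is_tree T,
        has_height T W,
        uncountable_branches T #= [set: L] &
        forall w : W, level T w #<= [set: W]]) ->
  exists (V : vocabulary) (M : structure V),
    [set: M] #= [set: W] /\ automorphisms M #= [set: L].
Proof.
move=> dW W W1 L [WL _] _ [d [T [treeT heightT branchesL levelsW]]].
have [ht [htP ht_lt ht_onto chain_below]] := exists_height W1 treeT heightT.
have Winf := omega1_infinite W1.
have Linf : infinite_set [set: L] by move=> /(card_le_finite WL)/Winf.
have threadsL : threads ht #= [set: L].
  exact: card_eq_trans (card_threads W1 ht_lt ht_onto chain_below) branchesL.
have TW : [set: T] #<= [set: W].
  apply: (card_union_levels Winf (ht := ht)) => w.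
  by apply: card_le_trans (levelsW w); apply: subset_card_le => x <-.
exists (torsor_vocabulary T W), (torsor_structure (proj ht)).
split; first exact: card_prod_fset.
have projD := proj_symdiff ht_lt ht_onto chain_below.
apply: card_eq_trans (card_torsor_automorphisms projD) _.
(* The upper bound comes from lists of threads, the lower bound from singletons. *)
apply/card_eqPle; split.
  apply: (coherent_le W1 ht_lt ht_onto chain_below Linf).
  by have /card_eqPle[] := threadsL.
apply: card_le_trans (threads_le_coherent ht_lt ht_onto chain_below).
by have /card_eqPle[] := threadsL.
Qed.
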